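(* Let $g$ and $\kappa$ be non-negative integers such that $2g = 3\kappa$. Then $\#\mathcal{G}_{\kappa}(g) = \#\mathcal{G}_{\kappa+n}(g+n)$ for all $n \in \mathbb{N}$.
   Context: $\mathbb{N}$ denotes the positive integers. A gapset is a finite set $G \subset \mathbb{N}$ such that whenever $z \in G$ and $z = x+y$ with $x,y \in \mathbb{N}$, then $x \in G$ or $y \in G$. The genus of $G$ is its cardinality $g$; we write $G = \{\ell_1 < \ell_2 < \cdots < \ell_g\}$. For $g \geq 2$, $G$ is pure $\kappa$-sparse if $\ell_{i+1}-\ell_i \leq \kappa$ for all $i \in \{1,\dots,g-1\}$ and $\ell_{i+1}-\ell_i = \kappa$ for some $i$. By convention, $\emptyset$ is pure $0$-sparse and $\{1\}$ is pure $1$-sparse (and for no other value of the parameter). $\mathcal{G}_\kappa(g)$ denotes the set of all pure $\kappa$-sparse gapsets of genus $g$, and $\#$ denotes cardinality. *)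

(* Defs.v *)
From mathcomp Require Import all_boot finmap.
From mathcomp Require Import boolp classical_sets functions cardinality.

Set Implicit Arguments.
Unset Strict Implicit.
Unset Printing Implicit Defensive.

Definition gapset (G : {fset nat}) : Prop :=
  0 \notin G /\
  forall x y z : nat, 0 < x -> 0 < y -> z \in G -> z = x + y ->
    x \in G \/ y \in G.

Definition genus (G : {fset nat}) : nat := #|` G|%fset.

(* The increasing enumeration, indexed from 0: [gap G i] is $\ell_{i+1}$ for
   [i < genus G], and the default value 0 beyond. *)
Definition gap (G : {fset nat}) (i : nat) : nat := nth 0 (sort leq G) i.

(* For [i.+1 < genus G] the truncated subtraction is a true difference. *)
Definition pure_sparse (k : nat) (G : {fset nat}) : Prop :=
  [\/ G = fset0%fset /\ k = 0,
      G = [fset 1]%fset /\ k = 1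
    | [/\ 2 <= genus G,
          forall i, i.+1 < genus G -> gap G i.+1 - gap G i <= k
        & exists2 i, i.+1 < genus G & gap G i.+1 - gap G i = k]].

Definition pure_sparse_gapsets (k g : nat) : set {fset nat} :=
  [set G | [/\ gapset G, genus G = g & pure_sparse k G]]%classic.

(* Main.v *)
(* Adjoin 0 to a gapset and record the successive differences. For 2g <= 3k and
   0 < k, prepending a difference 1 and increasing the last difference equal to
   k by one is a bijection from the pure k-sparse gapsets of genus g onto the
   pure (k+1)-sparse gapsets of genus g+1. Indeed all gaps are at most 2g - 1,
   while the multiplicity m is at least k and a difference k > 1 cannot occur
   before m - 1. So sums of two non-gaps reach the part beyond the enlarged
   difference only from positions that are shifted consistently, up to a tight
   case 2g = 3k, which is settled by taking the last difference equal to k. *)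
Require Import Defs.
From mathcomp Require Import all_boot finmap.
From mathcomp Require Import boolp classical_sets functions cardinality.
From mathcomp Require Import zify.

(** * Bounds on gaps and the multiplicity *)

Lemma gapset_gt0 (G : {fset nat}) (x : nat) : gapset G -> x \in G -> 0 < x.
Proof. by case=> G0 _; case: x => // /(negP G0). Qed.

(** A gap [z > 1] splits as [1 + (z - 1)], so one descends until 1 is reached. *)
Lemma gapset_1 (G : {fset nat}) (z : nat) : gapset G -> z \in G -> 1 \in G.
Proof.
move=> gG; elim: z => [/(gapset_gt0 _ _ gG) //|[//|z] IH zG].
by case: (gG.2 1 z.+1 z.+2 isT isT zG erefl) => // /IH.
Qed.

(* Among [x] and [z - x] at least one is a gap, for each of the [z + 1] values
   [0 <= x <= z]. *)
Lemma gapset_lt_double_genus (G : {fset nat}) (z : nat) :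
  gapset G -> z \in G -> z < 2 * genus G.
Proof.
move=> [_ gG] zG.
have -> : 2 * genus G = size (enum_fset G ++ [seq z - x | x <- enum_fset G]).
  by rewrite size_cat size_map mul2n -addnn.
rewrite -[z.+1](size_iota 0); apply: uniq_leq_size; first exact: iota_uniq.
move=> x; rewrite mem_iota add0n ltnS mem_cat => /andP[_ xz].
suff [xG|yG] : x \in G \/ z - x \in G.
- by apply/orP; left.
- by apply/orP; right; rewrite -(subKn xz); apply: map_f.
have [->|x0] := posnP x; first by rewrite subn0; right.
have [->|xz'] := eqVneq x z; first by left.
by apply: (gG x (z - x) z) => //; lia.
Qed.

Lemma multiplicity_exists (G : {fset nat}) : gapset G ->
  exists2 m, 0 < m /\ m \notin G & forall x, 0 < x -> x < m -> x \in G.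
Proof.
move=> gG; have ex : exists m, (0 < m) && (m \notin G).
  exists (2 * genus G).+1; rewrite /=; apply/negP.
  by move=> /(gapset_lt_double_genus _ _ gG); lia.
case: (ex_minnP ex) => m /andP[m0 mG] min; exists m => // x x0 xm.
by apply: contraLR xm => xG; rewrite -leqNgt min // x0.
Qed.

(** * Consecutive gaps and the maximal difference *)

(** Allowing [p = 0] gives the first gap a predecessor too. *)
Definition consecutive (G : {fset nat}) (p q : nat) : Prop :=
  [/\ p \in (0 |` G)%fset, q \in G, p < q
    & forall x, x \in G -> x <= p \/ q <= x].

(** If [m < k], then in [p + k = m + (p + k - m)] the second summand lies strictly between [p] and
    [p + k], so neither summand is a gap. *)
Lemma consecutive_le_nongap (G : {fset nat}) (p k m : nat) :
  gapset G -> consecutive G p (p + k) -> 0 < m -> m \notin G -> k <= m.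
Proof.
move=> [_ gG] [_ qG _ gap] m0 mG; rewrite leqNgt; apply/negP => mk.
have d0 : 0 < p + k - m by lia.
have dE : p + k = m + (p + k - m) by lia.
by case: (gG m _ _ m0 d0 qG dE) => [/(elimN idP mG)//|/gap]; lia.
Qed.

Lemma consecutive_ge_multiplicity (G : {fset nat}) (p k m : nat) :
  consecutive G p (p + k) -> 1 < k ->
  (forall x, 0 < x -> x < m -> x \in G) -> m <= p.+1.
Proof.
move=> [_ _ _ gap] k1 mG; rewrite leqNgt; apply/negP => pm.
by case: (gap p.+1 (mG _ _ pm)); lia.
Qed.

(* Adjoining 0 makes the conventions for the genera 0 and 1 agree with the
   general definition, as long as [0 < k]. *)
Definition max_gap (k : nat) (G : {fset nat}) : Prop :=
  (forall p q, consecutive G p q -> q <= p + k) /\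
  exists p, consecutive G p (p + k).

Lemma gap_ltn (G : {fset nat}) (i j : nat) :
  j < genus G -> i < j -> gap G i < gap G j.
Proof.
move=> jG ij; have sz : size (sort leq G) = genus G by rewrite size_sort.
apply: (sorted_ltn_nth ltn_trans); rewrite ?inE ?sz //.
  rewrite ltn_sorted_uniq_leq sort_uniq fset_uniq sort_sorted //.
  exact: leq_total.
exact: ltn_trans jG.
Qed.

Lemma gap_in (G : {fset nat}) (i : nat) : i < genus G -> gap G i \in G.
Proof. by move=> iG; rewrite -(mem_sort leq) mem_nth // size_sort. Qed.

Lemma gap_index (G : {fset nat}) (x : nat) :
  x \in G -> exists2 i, i < genus G & gap G i = x.
Proof.
rewrite -(mem_sort leq) => xG; exists (index x (sort leq G)).
  by move: xG; rewrite -index_mem size_sort.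
exact: nth_index.
Qed.

Lemma consecutive_gap (G : {fset nat}) (i : nat) :
  i.+1 < genus G -> consecutive G (gap G i) (gap G i.+1).
Proof.
move=> iG; have iG' := ltnW iG; split; rewrite ?inE ?gap_in ?orbT ?gap_ltn //.
move=> x /gap_index[j jG <-]; have [ji|ij] := leqP j i; [left|right].
  by move: ji; rewrite leq_eqVlt => /orP[/eqP ->//|/(gap_ltn _ _ _ iG')/ltnW].
by move: ij; rewrite leq_eqVlt => /orP[/eqP ->//|/(gap_ltn _ _ _ jG)/ltnW].
Qed.

Lemma consecutive_index (G : {fset nat}) (p q : nat) : consecutive G p q -> 0 < p ->
  exists2 i, i.+1 < genus G & p = gap G i /\ q = gap G i.+1.
Proof.
case=> + /gap_index[j jG <-] pq gaps p0; rewrite !inE => /orP[/eqP|]; first lia.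
move=> /gap_index[i iG ip]; subst p.
have ij : i < j.
  rewrite ltnNge leq_eqVlt; apply/negP => /orP[/eqP ji|/(gap_ltn _ _ _ iG)]; last lia.
  by move: pq; rewrite ji ltnn.
have iG' : i.+1 < genus G by lia.
exists i => //; split=> //.
move: ij; rewrite leq_eqVlt => /orP[/eqP ->//|/(gap_ltn _ _ _ jG)].
have := gap_ltn G i i.+1 iG' (ltnSn i).
by case: (gaps _ (gap_in _ _ iG')); lia.
Qed.

Lemma pure_sparse_max_gap (k : nat) (G : {fset nat}) : gapset G -> 0 < k ->
  pure_sparse k G <-> max_gap k G.
Proof.
move=> gG k0.
(* Adjoining 0 only adds a difference 1, since a nonempty gapset contains 1. *)
have q1 q : consecutive G 0 q -> q = 1.
  case=> _ qG q0 gaps; case: (gaps 1 (gapset_1 _ _ gG qG)); lia.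
split.
- case=> [[_ ?]|[GE ->]|[g2 le_k [i iG ik]]]; first lia.
    rewrite GE; split.
      by move=> p q [_ ]; rewrite inE => /eqP ->; lia.
    exists 0; split; rewrite ?inE // => x; rewrite inE => /eqP ->; lia.
  split; last first.
    exists (gap G i); rewrite -ik subnKC; first exact: consecutive_gap.
    by apply/ltnW/gap_ltn.
  move=> p q pq; have [p0|p0] := posnP p.
    by rewrite p0 in pq *; rewrite (q1 _ pq).
  by have [j jG [-> ->]] := consecutive_index _ _ _ pq p0; have := le_k j jG; lia.
- move=> [le_k [p pk]].
  have [/eqP /cardfs1P[x Gx]|g1] := eqVneq (genus G) 1.
    apply: Or32; have G1 : 1 \in G by case: pk => _ /(gapset_1 _ _ gG).
    move: G1 pk; rewrite Gx inE => /eqP <-; split=> //.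
    by case: pk => _; rewrite inE => /eqP; lia.
  have g2 : 1 < genus G.
    rewrite ltn_neqAle eq_sym g1 cardfs_gt0; apply/fset0Pn.
    by case: pk => _ pkG _ _; exists (p + k).
  apply: Or33; split=> // [i iG|].
    have := le_k _ _ (consecutive_gap _ _ iG); lia.
  have [p0|p0] := posnP p.
    (* Here [k = 1], so every difference is 1 and index 0 serves. *)
    rewrite p0 in pk; exists 0 => //.
    have := le_k _ _ (consecutive_gap _ _ g2).
    by have := gap_ltn _ _ _ g2 (ltn0Sn 0); have := q1 _ pk; lia.
  by have [i iG [pE qE]] := consecutive_index _ _ _ pk p0; exists i => //; lia.
Qed.

(** * The lengthening map and its effect on differences *)

Definition stretch (p x : nat) : nat := x.+1 + (p < x).

(* On the sequence of differences of [0 |` G], this prepends a 1 and adds 1 to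
   the difference following [p]. *)
Definition lengthen (p : nat) (G : {fset nat}) : {fset nat} :=
  (stretch p @` (0 |` G))%fset.

Lemma stretch_lo (p x : nat) : x <= p -> stretch p x = x.+1.
Proof. by rewrite /stretch; lia. Qed.

Lemma stretch_hi (p x : nat) : p < x -> stretch p x = x.+2.
Proof. by rewrite /stretch; lia. Qed.

Lemma stretch_ltn (p x y : nat) : (stretch p x < stretch p y) = (x < y).
Proof. by rewrite /stretch; lia. Qed.

Lemma stretch_leq (p x y : nat) : (stretch p x <= stretch p y) = (x <= y).
Proof. by rewrite leqNgt stretch_ltn -leqNgt. Qed.

Lemma stretch_inj (p : nat) : injective (stretch p).
Proof. by move=> x y; rewrite /stretch; lia. Qed.

Lemma mem_lengthen (p x : nat) (G : {fset nat}) :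
  (stretch p x \in lengthen p G) = (x \in (0 |` G)%fset).
Proof. by rewrite mem_imfset //; exact: stretch_inj. Qed.

Lemma mem_lengthen_lo (p x : nat) (G : {fset nat}) : 0 < x -> x <= p ->
  (x.+1 \in lengthen p G) = (x \in G).
Proof.
move=> x0 xp; have := mem_lengthen p x G; rewrite stretch_lo // => ->.
by rewrite !inE; case: eqP => // ?; lia.
Qed.

Lemma mem_lengthen_hi (p x : nat) (G : {fset nat}) : p < x ->
  (x.+2 \in lengthen p G) = (x \in G).
Proof.
move=> xp; have := mem_lengthen p x G; rewrite stretch_hi // => ->.
by rewrite !inE; case: eqP => // ?; lia.
Qed.

Lemma mem_lengthenP (p y : nat) (G : {fset nat}) : y \in lengthen p G ->
  exists2 x, x \in (0 |` G)%fset & y = stretch p x.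
Proof. by move=> /imfsetP[x /= xG ->]; exists x. Qed.

Lemma genus_lengthen (p : nat) (G : {fset nat}) :
  0 \notin G -> genus (lengthen p G) = (genus G).+1.
Proof.
move=> G0; rewrite /genus card_imfset; last exact: stretch_inj.
by rewrite /= -[size _]/(#|` (0 |` G)%fset|) cardfsU1 G0.
Qed.

Lemma consecutive_stretch (p a b : nat) (G : {fset nat}) :
  consecutive G a b -> consecutive (lengthen p G) (stretch p a) (stretch p b).
Proof.
case=> aG bG ab gaps; split; rewrite ?stretch_ltn //.
- by rewrite inE mem_lengthen aG orbT.
- by rewrite mem_lengthen inE bG orbT.
- move=> y /mem_lengthenP[x xG ->]; rewrite !stretch_leq.
  by move: xG; rewrite !inE => /orP[/eqP ->|/gaps //]; left.
Qed.

Lemma consecutive_lengthen (p r s : nat) (G : {fset nat}) :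
  consecutive (lengthen p G) r s -> r = 0 /\ s = 1 \/
  exists2 a, r = stretch p a & exists2 b, s = stretch p b & consecutive G a b.
Proof.
case=> rG /mem_lengthenP[b bG ->] rs gaps.
have one : stretch p 0 = 1 by [].
have G1 : 1 \in lengthen p G by rewrite -one mem_lengthen !inE.
move: rG; rewrite !inE => /orP[/eqP r0|/mem_lengthenP[a aG ra]].
  left; split=> //; case: (gaps _ G1); rewrite ?r0 //.
  by rewrite /stretch; lia.
right; exists a => //; exists b => //; subst r.
rewrite stretch_ltn in rs; split=> //.
  by move: bG rs; rewrite !inE => /orP[/eqP ->|].
move=> x xG; have := gaps (stretch p x).
rewrite mem_lengthen !inE xG orbT => /(_ isT).
by rewrite !stretch_leq.
Qed.

(** As [p] is 0 or a gap, no consecutive pair other than [(p, q)] has [p] on its left and [q] on its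
    right side, so [stretch p] shifts both its ends equally. *)
Lemma stretch_consecutive (p q a b : nat) (G : {fset nat}) :
  consecutive G p q -> consecutive G a b ->
  a = p /\ b = q \/ stretch p b = stretch p a + (b - a) /\ a != p.
Proof.
move=> [pG qG pq gaps] [aG bG ab gaps'].
have [ap|ap] := eqVneq a p.
  left; split=> //; move: (gaps b bG) (gaps' q qG); subst; lia.
right; split=> //; rewrite /stretch.
have [?|pa] := leqP a p; have [?|pb] := leqP b p; try lia.
by move: pG; rewrite !inE => /orP[/eqP ?|/gaps']; lia.
Qed.

Lemma consecutive_enlarged (p k : nat) (G : {fset nat}) :
  consecutive G p (p + k) -> consecutive (lengthen p G) p.+1 (p.+1 + k.+1).
Proof.
move=> pk; have := consecutive_stretch p _ _ _ pk.
have -> : p.+1 + k.+1 = (p + k).+2 by lia.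
by rewrite stretch_lo // stretch_hi //; case: pk.
Qed.

Lemma max_gap_lengthen (p k : nat) (G : {fset nat}) :
  consecutive G p (p + k) -> max_gap k G -> max_gap k.+1 (lengthen p G).
Proof.
move=> pk [le_k _]; split.
  move=> r s /consecutive_lengthen[[-> ->]|[a -> [b -> ab]]]; first lia.
  case: (stretch_consecutive _ _ _ _ _ pk ab) => [[-> ->]|[-> _]].
    by rewrite /stretch; lia.
  by have := le_k _ _ ab; lia.
by exists p.+1; exact: consecutive_enlarged.
Qed.

(** Only the difference after [p] grows beyond [k], so the image determines [p]; injectivity rests
    on this. *)
Lemma lengthen_gap_unique (p k r : nat) (G : {fset nat}) : 0 < k ->
  consecutive G p (p + k) -> (forall a b, consecutive G a b -> b <= a + k) ->
  consecutive (lengthen p G) r (r + k.+1) -> r = p.+1.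
Proof.
move=> k0 pk le_k /consecutive_lengthen[[-> ?]|[a ra [b sb ab]]]; first lia.
case: (stretch_consecutive _ _ _ _ _ pk ab) => [[ap _]|[E _]].
  by rewrite ra ap stretch_lo.
by have := le_k _ _ ab; lia.
Qed.

(** * Lengthening preserves and reflects the gapset condition *)

(* With [m] the multiplicity, a sum of two non-elements of the new set can lie
   in it only if it comes from some [z \in G] with [z >= p + k + m]. The bound
   [z < 2 * genus G <= 3 * k] then forces [m = k], [p = k - 1] and
   [z = 3 * k - 1], so that [p + k] starts another gap of size [k]. *)
Lemma gapset_lengthen (p k : nat) (G : {fset nat}) :
  gapset G -> 0 < k -> 2 * genus G <= 3 * k -> consecutive G p (p + k) ->
  (forall r, consecutive G r (r + k) -> r <= p) -> gapset (lengthen p G).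
Proof.
move=> gG k0 gk pk last_p; have [pG qG pq gaps] := pk.
have bound z := gapset_lt_double_genus G z gG.
have [m [m0 mG] lt_m] := multiplicity_exists G gG.
have km := consecutive_le_nongap _ _ _ _ gG pk m0 mG.
have mp := consecutive_ge_multiplicity _ _ _ m pk.
have G1 : 1 \in lengthen p G by rewrite -[1]/(stretch p 0) mem_lengthen !inE.
split.
  by apply/negP => /mem_lengthenP[x _]; rewrite /stretch.
suff wl x y : 0 < x -> x <= y -> x + y \in lengthen p G ->
    x \in lengthen p G \/ y \in lengthen p G.
  move=> x y z x0 y0 + zE; rewrite zE => zG.
  have [xy|/ltnW yx] := leqP x y; first exact: wl.
  by case: (wl y x y0 yx); rewrite 1?addnC //; [right|left].
case: x => [//|[|u]] _ xy; first by left.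
case: y xy => [//|v] uv.
move=> /mem_lengthenP[z zG]; rewrite !inE in zG.
have {}zG : z \in G \/ z = 0 by case/orP: zG => [/eqP|]; [right|left].
case: (leqP z p) => zp; rewrite 1?(stretch_lo _ _ zp) 1?(stretch_hi _ _ zp) => zE.
  (* Here [z = u.+1 + v.+1] and [z <= p < 2 * k], so the smaller part [u.+1] is below [k <= m]. *)
  left; rewrite mem_lengthen_lo //; last lia.
  have := bound _ qG; case: (ltnP u.+1 m) => [um _|]; first exact: lt_m.
  lia.
case: zG => [zG|]; last lia.
have bz := bound z zG.
have {}mp : m <= p.+1 by apply: mp => //; lia.
have lo w : 0 < w -> w < p + k -> w \in G -> w.+1 \in lengthen p G.
  by move=> w0 wq wG; case: (gaps w wG) => [wp|]; [rewrite mem_lengthen_lo|lia].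
(* Now [z = u.+1 + v]: while [v < p + k], a gap among these summands is at most [p] and is shifted
   by exactly 1. *)
have [vq|qv] := ltnP v (p + k).
  case: (gG.2 u.+1 v z) => //; try lia.
    by move=> uG; left; apply: lo => //; lia.
  by move=> vG; right; apply: lo => //; lia.
have [um|mu] := ltnP u.+1 m; first by left; apply: lo; [| |exact: lt_m]; lia.
have [mk pm vE] : [/\ m = k, p.+1 = k & v = p + k] by split; lia.
suff /last_p : consecutive G (p + k) (p + k + k) by lia.
have zk : z = p + k + k by lia.
split; rewrite ?inE ?qG ?orbT -?zk //; first lia.
move=> w wG; case: (leqP w (p + k)) => qw; first by left.
right; rewrite leqNgt; apply/negP => wz.
(* [k = m] is not a gap, and [w - k] lies strictly between [p] and [p + k]. *)
case: (gG.2 k (w - k) w) => //; try lia; first by rewrite -mk => /(negP mG).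
by case/gaps; lia.
Qed.

(* Two gaps of size [k] force them to start at [k - 1] and [2 * k - 1]; enlarging
   the first one would make [3 * k + 1 = (k + 1) + 2 * k] violate the gapset
   condition. *)
Lemma lengthen_gap_last (p k r : nat) (G : {fset nat}) :
  gapset G -> gapset (lengthen p G) -> 0 < k -> 2 * genus G <= 3 * k ->
  consecutive G p (p + k) -> consecutive G r (r + k) -> r <= p.
Proof.
move=> gG gG' k0 gk pk rk; rewrite leqNgt; apply/negP => pr.
have [_ _ _ gaps] := pk; have [rG rkG _ _] := rk.
have bd := gapset_lt_double_genus G _ gG rkG.
have qr : p + k <= r.
  by move: rG; rewrite !inE => /orP[/eqP ?|/gaps]; lia.
have [m [m0 mG] lt_m] := multiplicity_exists G gG.
have km := consecutive_le_nongap _ _ _ _ gG pk m0 mG.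
have mp := consecutive_ge_multiplicity _ _ _ m pk.
have k1 : 1 < k by lia.
have {}mp := mp k1 lt_m.
have pk1 : p.+1 = k by lia.
(* After lengthening, the enlarged difference runs from [k] to [2 * k + 1]. *)
have nG x : k < x -> x <= k + k -> x \notin lengthen p G.
  move=> kx xk; apply/negP => /mem_lengthenP[w]; rewrite !inE.
  by rewrite /stretch => /orP[/eqP ->|/gaps[]]; lia.
have : (r + k).+2 \in lengthen p G by rewrite mem_lengthen_hi //; lia.
have kk : (r + k).+2 = k.+1 + (k + k) by lia.
have k20 : 0 < k + k by lia.
by move=> rG'; case: (gG'.2 k.+1 _ _ isT k20 rG' kk); apply/negP/nG; lia.
Qed.

(** The multiplicity of the lengthened set exceeds [k], so all positive [w < k] lie in [G]. If
    [z <= p < 2 * k], the smaller summand is below [k]. Otherwise [z.+2 = x.+1 + y.+1] yields a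
    summand in the lengthened set; if it comes from beyond the enlarged difference, the other
    summand is small enough to lie in [G]. *)
Lemma gapset_of_lengthen (p k : nat) (G : {fset nat}) :
  0 \notin G -> gapset (lengthen p G) -> 0 < k -> 2 * genus G <= 3 * k ->
  consecutive G p (p + k) -> gapset G.
Proof.
move=> G0 gG' k0 gk pk; split=> // x y z x0 y0 zG zE.
have := genus_lengthen p G G0.
set G' := lengthen p G in gG' * => gE.
have bound w := gapset_lt_double_genus G' w gG'.
have [pG qG _ gaps] := pk.
have pk' : consecutive G' p.+1 (p.+1 + k.+1) by exact: consecutive_enlarged.
have [m [m0 mG] lt_m] := multiplicity_exists G' gG'.
have km := consecutive_le_nongap _ _ _ _ gG' pk' m0 mG.
have mp := consecutive_ge_multiplicity _ _ _ m pk' _ lt_m.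
have qG' : p.+1 + k.+1 \in G' by case: pk'.
have bq := bound _ qG'.
have small w : 0 < w -> w.+1 < m -> w \in G.
  by move=> w0 wm; rewrite -(mem_lengthen_lo p) ?lt_m //; lia.
case: (gaps z zG) => zpq.
  by case: (leqP y x) => xy; [right|left]; apply: small; lia.
have zG' : z.+2 \in G' by rewrite mem_lengthen_hi //; lia.
have bz := bound _ zG'.
have half u v : 0 < u -> 0 < v -> z = u + v -> u.+1 \in G' -> u \in G \/ v \in G.
  move=> u0 v0 zuv uG'; have [up|pu] := leqP u p.
    by left; rewrite -(mem_lengthen_lo p).
  right; apply: small => //.
  move/mem_lengthenP: uG' => [w]; rewrite !inE /stretch.
  by move=> /orP[/eqP ->|/gaps[]]; lia.
case: (gG'.2 x.+1 y.+1 z.+2) => //; first lia; first exact: half.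
by rewrite addnC in zE; case/(half y x) => //; [right|left].
Qed.

(** * Inverting the lengthening *)

Lemma lengthen_surj (k r : nat) (G' : {fset nat}) :
  gapset G' -> 0 < k -> consecutive G' r (r + k.+1) ->
  exists p (G : {fset nat}),
    [/\ G' = lengthen p G, 0 \notin G, r = p.+1 & consecutive G p (p + k)].
Proof.
move=> gG' k0 rk; have [rG qG _ gaps] := rk.
have G1 := gapset_1 _ _ gG' qG.
have r0 : 0 < r by case: (gaps 1 G1); lia.
(* The preimage of [G'] under [stretch], without 0; the range [iota] loses nothing, as elements of
   [G'] are below [2 * genus G']. *)
pose G := [fset x in iota 1 (2 * genus G') | stretch r.-1 x \in G']%fset.
have memG x : (x \in G) = (0 < x) && (stretch r.-1 x \in G').
  rewrite !inE mem_iota; apply: andb_id2r => /(gapset_lt_double_genus _ _ gG').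
  by rewrite /stretch; lia.
exists r.-1, G; split; rewrite ?memG ?prednK //.
  apply/fsetP => y; apply/idP/imfsetP => /= [yG|[x + ->]].
    have y0 := gapset_gt0 _ _ gG' yG.
    have [y1|y1] := eqVneq y 1; first by exists 0; rewrite ?inE.
    (* The only positive value that [stretch r.-1] misses is [r.+1], which lies inside the long
       difference. *)
    have yE : y = stretch r.-1 (if y <= r then y.-1 else y.-2).
      by case: (gaps y yG) => yr; case: ifPn => ?; rewrite /stretch; lia.
    exists (if y <= r then y.-1 else y.-2) => //.
    rewrite in_fset1U memG -yE yG andbT; apply/orP; right.
    by case: (gaps y yG); case: ifP; lia.
  by rewrite in_fset1U memG => /orP[/eqP ->|/andP[]].
split; last first.
- move=> x; rewrite memG => /andP[x0 /gaps]; rewrite /stretch; lia.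
- lia.
- rewrite memG stretch_hi; last lia.
  have -> : (r.-1 + k).+2 = r + k.+1 by lia.
  by rewrite qG andbT; lia.
- rewrite in_fset1U memG stretch_lo // prednK //.
  move: rG; rewrite !inE => /orP[/eqP|->]; lia.
Qed.

(** The first such difference starts at [k - 1] or later, so a second one would end at [3 * k - 1]
    or later, contrary to the bound [2 * genus G - 1] on gaps. *)
Lemma long_gap_unique (k r s : nat) (G : {fset nat}) :
  gapset G -> 1 < k -> 2 * genus G < 3 * k ->
  consecutive G r (r + k) -> consecutive G s (s + k) -> r = s.
Proof.
move=> gG k1 gk.
wlog rs : r s / r < s => [wl rk sk|rk sk].
  by case: (ltngtP r s) => // [/wl|/wl] ->.
have [_ _ _ gaps] := rk; have [sG skG _ _] := sk.
have bd := gapset_lt_double_genus G _ gG skG.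
have [m [m0 mG] lt_m] := multiplicity_exists G gG.
have km := consecutive_le_nongap _ _ _ _ gG rk m0 mG.
have mr := consecutive_ge_multiplicity _ _ _ m rk k1 lt_m.
by move: sG; rewrite !inE => /orP[/eqP ?|/gaps]; lia.
Qed.

(** A difference exceeding [k] in [G] would survive as a second difference [k.+1] in the lengthened
    set. *)
Lemma max_gap_of_lengthen (p k : nat) (G : {fset nat}) :
  gapset (lengthen p G) -> 0 \notin G -> 0 < k -> 2 * genus G <= 3 * k ->
  consecutive G p (p + k) -> max_gap k.+1 (lengthen p G) -> max_gap k G.
Proof.
move=> gG' G0 k0 gk pk [le_k _]; split; last by exists p.
move=> a b ab; have ab' := consecutive_stretch p _ _ _ ab.
case: (stretch_consecutive _ _ _ _ _ pk ab) => [[-> ->] //|[E ap]].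
have bound := le_k _ _ ab'; have [_ _ ltab _] := ab.
rewrite leqNgt; apply/negP => kab.
have Eb : stretch p b = stretch p a + k.+1 by lia.
have pk' := consecutive_enlarged _ _ _ pk.
rewrite Eb in ab'.
move/eqP: ap; apply; apply: (@stretch_inj p); rewrite [RHS]stretch_lo //.
apply: (long_gap_unique k.+1 _ _ _ gG' _ _ ab' pk') => //.
by rewrite genus_lengthen //; lia.
Qed.

(** * The bijection between successive parameters *)

Definition last_gap (k : nat) (G : {fset nat}) (p : nat) : Prop :=
  consecutive G p (p + k) /\ forall r, consecutive G r (r + k) -> r <= p.

Lemma last_gap_unique (k : nat) (G : {fset nat}) (p r : nat) :
  last_gap k G p -> last_gap k G r -> p = r.
Proof. by move=> [pk lp] [rk lr]; apply/eqP; rewrite eqn_leq lr ?lp. Qed.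

Lemma last_gap_exists (k : nat) (G : {fset nat}) :
  gapset G -> max_gap k G -> exists p, last_gap k G p.
Proof.
move=> gG [_ ex].
have ex' : exists p, `[< consecutive G p (p + k) >].
  by case: ex => p pk; exists p; apply/asboolP.
have ub p : `[< consecutive G p (p + k) >] -> p <= 2 * genus G.
  by move=> /asboolP[_ /(gapset_lt_double_genus _ _ gG)]; lia.
case: (ex_maxnP ex' ub) => p /asboolP pk max; exists p; split=> // r rk.
by apply: max; apply/asboolP.
Qed.

Lemma pure_sparse_gapsets_succ (k g : nat) : 0 < k -> 2 * g <= 3 * k ->
  (pure_sparse_gapsets k g #= pure_sparse_gapsets k.+1 g.+1)%card.
Proof.
(* The default 0 of [xget] is never taken on the sets considered, by [AP]. *)
move=> k0 gk; pose P G := xget 0 (last_gap k G).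
have AP G : pure_sparse_gapsets k g G -> last_gap k G (P G).
  move=> [gG _ /(pure_sparse_max_gap _ _ gG k0) mk].
  by apply: xgetPex; exact: last_gap_exists.
suff -> : pure_sparse_gapsets k.+1 g.+1 =
    [set lengthen (P G) G | G in pure_sparse_gapsets k g]%classic.
  rewrite card_eq_sym; apply: inj_card_eq => G H /set_mem AG /set_mem AH GH.
  have [Gk _] := AP _ AG; have [Hk _] := AP _ AH.
  have [gG _ /(pure_sparse_max_gap _ _ gG k0) [leG _]] := AG.
  have [gH _ /(pure_sparse_max_gap _ _ gH k0) mH] := AH.
  (* The only difference [k.+1] of the common image starts at both [(P G).+1] and [(P H).+1]. *)
  have [_ [r rk]] := max_gap_lengthen _ _ _ Hk mH.
  have rH := lengthen_gap_unique _ _ _ _ k0 Hk mH.1 rk.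
  rewrite -GH in rk; have rG := lengthen_gap_unique _ _ _ _ k0 Gk leG rk.
  have PE : P G = P H by lia.
  rewrite -PE in GH; apply/fsetP => x.
  have := mem_lengthen (P G) x G; rewrite GH mem_lengthen !in_fset1U.
  case: eqVneq => // -> _.
  by rewrite (negbTE gG.1) (negbTE gH.1).
apply/seteqP; split=> [G' [gG' g'E /(pure_sparse_max_gap _ _ gG' (ltn0Sn k)) mk']|].
  have [r rk] := mk'.2.
  have [p [G [G'E G0 rp pk]]] := lengthen_surj _ _ _ gG' k0 rk.
  subst G'; move: g'E; rewrite genus_lengthen // => -[gE].
  have gk' : 2 * genus G <= 3 * k by rewrite gE.
  have gG := gapset_of_lengthen _ _ _ G0 gG' k0 gk' pk.
  have AG : pure_sparse_gapsets k g G.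
    split=> //; apply/pure_sparse_max_gap => //.
    exact: max_gap_of_lengthen mk'.
  exists G => //; congr (lengthen _ G).
  (* The position found in the preimage must be the chosen one, since it too is the last. *)
  apply: (last_gap_unique k G _ _ (AP _ AG)); split=> // s.
  exact: lengthen_gap_last pk.
move=> _ [G AG <-]; have [Gk last_P] := AP _ AG.
have [gG gE /(pure_sparse_max_gap _ _ gG k0) mk] := AG.
have gG' : gapset (lengthen (P G) G).
  by apply: (gapset_lengthen _ k); rewrite ?gE.
split=> //; first by rewrite genus_lengthen ?gE //; exact: gG.1.
by apply/pure_sparse_max_gap => //; exact: max_gap_lengthen.
Qed.

(** * The degenerate case and the induction on [n] *)

Lemma pure_sparse_gapsets_00 : pure_sparse_gapsets 0 0 = [set fset0]%classic.
Proof.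
apply/seteqP; split=> [G [_ /eqP + _]|_ ->] /=.
  by rewrite cardfs_eq0 => /eqP.
by split; [split; rewrite ?inE //| rewrite /genus cardfs0 | apply: Or31].
Qed.

Lemma pure_sparse_gapsets_11 :
  pure_sparse_gapsets 1 1 = [set [fset 1]%fset]%classic.
Proof.
apply/seteqP; split=> [G [gG /eqP /cardfs1P[x Gx] _]|_ ->] /=.
  have := gapset_1 G x gG; rewrite Gx !inE eqxx => /(_ isT) /eqP <- //.
split; [split; rewrite ?inE // | by rewrite /genus cardfs1 | exact: Or32].
by move=> x y z x0 y0; rewrite inE => /eqP ->; lia.
Qed.

Theorem corollary5p2 (g k : nat) (hgk : 2 * g = 3 * k) (n : nat) (hn : 0 < n) :
  (pure_sparse_gapsets k g #= pure_sparse_gapsets (k + n) (g + n))%card.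
Proof.
elim: n hn => // n IH _; rewrite !addnS.
have [n0|n0] := posnP n.
  rewrite n0 !addn0; have [k0|k0] := posnP k.
    have g0 : g = 0 by lia.
    rewrite k0 g0 pure_sparse_gapsets_00 pure_sparse_gapsets_11.
    exact: eq_card1.
  by apply: pure_sparse_gapsets_succ => //; rewrite hgk.
(* Each step adds 2 to [2 * g] and 3 to [3 * k], so the required inequality persists. *)
by apply: card_eq_trans (IH n0) _; apply: pure_sparse_gapsets_succ; lia.
Qed.
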